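(* Let $f:\mathbb{R}^n\to[0,1]$ and $g:\mathbb{R}^m\to[0,1]$ be smooth, and let $U=\begin{pmatrix}u_{0,0}&u_{0,1}\\ u_{1,0}&u_{1,1}\end{pmatrix}$ be a real matrix with $v:=u_{0,0}-u_{0,1}-u_{1,0}+u_{1,1}\neq0$, $q:=-\frac{u_{0,1}-u_{1,1}}{v}\in(0,1)$ and $p:=-\frac{u_{1,0}-u_{1,1}}{v}\in(0,1)$. Let $F(\theta)=(f(\theta),1-f(\theta))^\top$, $G(\phi)=(g(\phi),1-g(\phi))^\top$, $r(\theta,\phi)=F(\theta)^\top U G(\phi)$, $P=(p,1-p)^\top$ and $Q=(q,1-q)^\top$. Let $(\theta(0),\phi(0))\in\mathbb{R}^n\times\mathbb{R}^m$ be a safe initial condition and let $(\theta(t),\phi(t))$ be the solution, with this initial condition, of $$\dot{\theta}=-v\,\nabla f(\theta)\,(g(\phi)-q),\qquad \dot{\phi}=v\,\nabla g(\phi)\,(f(\theta)-p).$$ Then $$\lim_{T\to\infty}\frac1T\int_0^T f(\theta(t))\,dt=p,\qquad \lim_{T\to\infty}\frac1T\int_0^T r(\theta(t),\phi(t))\,dt=P^\top U Q,\qquad \lim_{T\to\infty}\frac1T\int_0^T g(\phi(t))\,dt=q.$$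
   Context: The system is continuous-time gradient-descent-ascent for $r$ ($\theta$ descends, $\phi$ ascends); $(p,q)$ is the unique mixed Nash equilibrium of the hidden bilinear game $U$. Gradient ascent dynamics of $f$ from $\theta(0)$: let $\gamma:\mathbb{R}\to\mathbb{R}^n$ be the solution of $\dot\gamma=\nabla f(\gamma)$, $\gamma(0)=\theta(0)$, and define $f_{\theta(0)}=\{f(\gamma(s)):s\in\mathbb{R}\}$. $g_{\phi(0)}$ is defined in the same way from $g$ and $\phi(0)$. The initial condition $(\theta(0),\phi(0))$ is called safe if $\theta(0)$ is not a stationary point of $f$, $\phi(0)$ is not a stationary point of $g$, $p\in f_{\theta(0)}$ and $q\in g_{\phi(0)}$. *)

(* Defs.v *)
(* MathComp-Analysis: [R : realType], R^n is ['rV[R]_n]. *)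
From mathcomp Require Export all_boot all_order all_algebra.
From mathcomp Require Export all_classical all_reals all_analysis.

Export Order.TTheory GRing.Theory Num.Theory.
Export numFieldNormedType.Exports.

#[export] Set Implicit Arguments.
#[export] Unset Strict Implicit.
#[export] Unset Printing Implicit Defensive.

Local Open Scope classical_set_scope.
Local Open Scope ring_scope.

Definition partial (R : realType) (n : nat) (i : 'I_n) (f : 'rV[R]_n -> R)
  : 'rV[R]_n -> R := fun x => 'D_(delta_mx 0 i) f x.

Definition grad (R : realType) (n : nat) (f : 'rV[R]_n -> R) (x : 'rV[R]_n)
  : 'rV[R]_n := \row_(i < n) partial i f x.

(* Differentiability here is Frechet; together with C^k partial derivatives
   it says that [f] is C^k.+1. *)
Fixpoint class_C (k : nat) (R : realType) (n : nat) (f : 'rV[R]_n -> R)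
  : Prop :=
  match k with
  | 0%N => continuous f
  | k'.+1 =>
      (forall x, differentiable f x) /\
      (forall i : 'I_n, class_C k' (partial i f))
  end.

Definition smooth (R : realType) (n : nat) (f : 'rV[R]_n -> R) : Prop :=
  forall k, class_C k f.

Definition gradient_ascent (R : realType) (n : nat) (f : 'rV[R]_n -> R)
  (x0 : 'rV[R]_n) (gamma : R -> 'rV[R]_n) : Prop :=
  gamma 0 = x0 /\ forall s : R, is_derive s (1 : R) gamma (grad f (gamma s)).

(* For smooth [f] at most one [gamma] satisfies [gradient_ascent f x0 gamma],
   so the existential merely names the solution. *)
Definition ascent_values (R : realType) (n : nat) (f : 'rV[R]_n -> R)
  (x0 : 'rV[R]_n) : set R :=
  [set y | exists2 gamma : R -> 'rV[R]_n,
             gradient_ascent f x0 gamma & exists s : R, f (gamma s) = y].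

Definition safe (R : realType) (n m : nat) (f : 'rV[R]_n -> R)
  (g : 'rV[R]_m -> R) (p q : R) (theta0 : 'rV[R]_n) (phi0 : 'rV[R]_m)
  : Prop :=
  [/\ grad f theta0 != 0, grad g phi0 != 0,
      ascent_values f theta0 p & ascent_values g phi0 q].

(* The column vector (x, 1 - x)^T. *)
Definition mixed (R : realType) (x : R) : 'cV[R]_2 :=
  \col_(i < 2) (if i == 0 then x else 1 - x).

Definition payoff (R : realType) (U : 'M[R]_2) (X Y : 'cV[R]_2) : R :=
  (X^T *m U *m Y) 0 0.

(* [theta] and [phi] are total functions, but only their values at
   nonnegative times are constrained: continuous on [0, +oo[, and solving
   the system for t > 0. *)
Definition gda_solution (R : realType) (n m : nat) (f : 'rV[R]_n -> R)
  (g : 'rV[R]_m -> R) (v p q : R) (theta0 : 'rV[R]_n) (phi0 : 'rV[R]_m)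
  (theta : R -> 'rV[R]_n) (phi : R -> 'rV[R]_m) : Prop :=
  [/\ theta 0 = theta0 /\ phi 0 = phi0,
      {within `[0, +oo[, continuous theta},
      {within `[0, +oo[, continuous phi} &
      forall t : R, 0 < t ->
        is_derive t (1 : R) theta
          (- (v * (g (phi t) - q)) *: grad f (theta t)) /\
        is_derive t (1 : R) phi
          ((v * (f (theta t) - p)) *: grad g (phi t))].

Definition time_average (R : realType) (h : R -> R) (T : R) : R :=
  T^-1 * \int[lebesgue_measure]_(t in `[0, T]) h t.

(* Main.v *)
Require Import Defs.
From mathcomp Require Import ring lra.

(** Each player moves along a fixed curve with a variable speed. Let [gam] be
    the gradient ascent curve of [f] from [theta0], and let [a] be the
    primitive of [- v (g (phi t) - q)] with [a 0 = 0]. Both [theta] and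
    [gam \o a] solve [x' = a' grad f(x)] from [theta0], so they agree
    ([ode_unique]), and [f (theta t) = F (a t)] with [F = f \o gam]. Likewise
    [g (phi t) = G (b t)], where [b] is the primitive of [v (f (theta t) - p)].
    The whole system is thus reduced to the planar Hamiltonian system
      [a' = - v (G b - q)],  [b' = v (F a - p)],
    whose energy [Phi a + Psi b], with [Phi' = F - p] and [Psi' = G - q], is
    constant in time.

    Safety makes the energy coercive. As [theta0] is not stationary, no point
    of [gam] is ([gradient_ascent_grad_neq0]), so [F] increases strictly; it
    takes the value [p], so [Phi] is strictly convex with a minimum and grows
    at least linearly in both directions ([increasing_primitive_coercive]).
    The same holds for [Psi], and hence [a] and [b] stay bounded
    ([energy_bounded]).

    Bounded primitives give the three limits at once ([time_average_cvg]):
    - [g (phi t) - q] is the derivative of [- a / v];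
    - [f (theta t) - p] is the derivative of [b / v];
    - the payoff minus its equilibrium value is
      [v (f (theta t) - p) (g (phi t) - q)], the derivative of [- Phi (a t)]. *)

Local Open Scope classical_set_scope.
Local Open Scope ring_scope.

(** * Differential calculus along curves *)

Lemma is_derive_continuous (R : realType) (V : normedModType R) (h : R -> V)
  (t : R) (dh : V) : is_derive t 1 h dh -> {for t, continuous h}.
Proof.
by move=> hh; apply/differentiable_continuous/derivable1_diffP; exact: ex_derive.
Qed.

Lemma is_derive_coord (R : realType) (n : nat) (x : R -> 'rV[R]_n) (t : R)
  (dx : 'rV[R]_n) (i : 'I_n) :
  is_derive t 1 x dx -> is_derive t 1 (fun s => x s 0 i) (dx 0 i).
Proof.
move=> [xt <-]; rewrite derive_mx// mxE.
by apply/derivableP; have /derivable_mxP := xt; exact.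
Qed.

Lemma is_derive_comp_grad (R : realType) (n : nat) (f : 'rV[R]_n -> R)
  (x : R -> 'rV[R]_n) (t : R) (dx : 'rV[R]_n) :
  differentiable f (x t) -> is_derive t 1 x dx ->
  is_derive t 1 (f \o x) (\sum_(i < n) dx 0 i * grad f (x t) 0 i).
Proof.
move=> df [dxt dxE].
have dX : differentiable x t by apply/derivable1_diffP.
apply: DeriveDef.
  by apply/derivable1_diffP; exact: differentiable_comp.
rewrite deriveE; last exact: differentiable_comp.
rewrite diff_comp//= -(deriveE _ dX) dxE.
rewrite {1}(row_sum_delta dx) linear_sum/=; apply: eq_bigr => i _.
by rewrite linearZ/= mxE /partial deriveE.
Qed.

Lemma is_derive_reparam (R : realType) (V : normedModType R) (gam : R -> V)
  (b : R -> R) (t db : R) (dgam : V) :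
  is_derive (b t) (1 : R) gam dgam -> is_derive t (1 : R) b db ->
  is_derive t (1 : R) (gam \o b) (db *: dgam).
Proof.
move=> [dg <-] [d_b <-].
have Dg : differentiable gam (b t) by apply/derivable1_diffP.
have Db : differentiable b t by apply/derivable1_diffP.
apply: DeriveDef; first by apply/derivable1_diffP; exact: differentiable_comp.
rewrite deriveE; last exact: differentiable_comp.
have dlin (w : R) : 'd gam (b t) w = w *: 'd gam (b t) (1 : R).
  by rewrite -linearZ/= [_ *: 1]mulr1.
by rewrite diff_comp//= dlin !deriveE.
Qed.

Lemma coord_le_norm (R : realType) (n : nat) (x : 'rV[R]_n) (i : 'I_n) :
  `|x 0 i| <= `|x|.
Proof.
rewrite [leRHS]/Num.norm/= mx_normrE.
exact: (le_bigmax _ (fun ij : 'I_1 * 'I_n => `|x ij.1 ij.2|) (0, i)).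
Qed.

(** The norm on row vectors is the sup norm; this compares it with the
    Euclidean one, whose square is differentiable. *)
Lemma norm2_le_sum (R : realType) (n : nat) (x : 'rV[R]_n) :
  `|x| ^+ 2 <= \sum_(i < n) x 0 i ^+ 2.
Proof.
have [->|x0] := eqVneq x 0.
  by rewrite normr0 expr0n/= sumr_ge0// => i _; exact: sqr_ge0.
have [|[k i] xE] := @mx_norm_neq0 _ _ _ x; first by rewrite -normr_eq0 in x0.
rewrite (_ : `|x| = `|x k i|)//.
rewrite real_normK ?num_real// (ord1 k) (bigD1 i)//= lerDl.
by rewrite sumr_ge0// => j _; exact: sqr_ge0.
Qed.

Lemma bounded_on_ball (R : realType) (n : nat) (h : 'rV[R]_n -> R) (r : R) :
  continuous h -> exists M : R, forall x, `|x| <= r -> `|h x| <= M.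
Proof.
move=> ch.
have cB : compact (closed_ball_ (fun x : 'rV[R]_n => `|x|) 0 r).
  apply: bounded_closed_compact; last exact: closed_closed_ball_.
  exists r; split; first exact: num_real.
  move=> M rM x; rewrite /closed_ball_/= sub0r normrN => /le_trans; apply.
  exact: ltW.
have /compact_bounded [M [_ HM]] :
    compact (h @` closed_ball_ (fun x : 'rV[R]_n => `|x|) 0 r).
  by apply: continuous_compact => //; exact: continuous_subspaceT.
exists (M + 1) => x xr; apply: (HM (M + 1)); first by rewrite ltrDl.
by exists x => //; rewrite /closed_ball_/= sub0r normrN.
Qed.

(** Mean value theorem on the segment from [y] to [x], which stays in the ball;
    [L] is the sum over [i] of bounds for the partial derivatives there. *)
Lemma locally_lipschitz (R : realType) (n : nat) (h : 'rV[R]_n -> R) (r : R) :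
  class_C 1 h -> exists L, forall x y, `|x| <= r -> `|y| <= r ->
    `|h x - h y| <= L * `|x - y|.
Proof.
move=> [dh ch].
have bd (i : 'I_n) : exists M : R, forall x, `|x| <= r -> `|partial i h x| <= M.
  by apply: bounded_on_ball; exact: ch.
have {bd}[M HM] := choice bd.
exists (\sum_(i < n) M i) => x y xr yr.
pose z (t : R) : 'rV[R]_n := y + t *: (x - y).
have dz (t : R) : is_derive t (1 : R) z (x - y).
  have dl : is_derive t (1 : R) ( *:%R^~ (x - y) : R -> 'rV[R]_n) (x - y).
    apply: DeriveDef; first exact/derivable1_diffP.
    by rewrite deriveE// diff_val scale1r.
  have zE : z = cst y + ( *:%R^~ (x - y) : R -> 'rV[R]_n) by apply/funext => s.
  rewrite zE.
  have := is_deriveD (is_derive_cst y t (1:R)) dl.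
  by rewrite add0r.
pose dh_z (t : R) := \sum_(i < n) (x - y) 0 i * grad h (z t) 0 i.
have dhz (t : R) : is_derive t (1 : R) (h \o z) (dh_z t).
  exact: is_derive_comp_grad.
have [] := MVT ltr01 (fun t _ => dhz t).
  by apply: continuous_subspaceT => t; apply: is_derive_continuous (dhz t).
move=> t /[!in_itv]/= /andP[t0 t1].
rewrite /dh_z /z/= scale0r scale1r addr0 subrKC subr0 mulr1 => ->.
rewrite (le_trans (ler_norm_sum _ _ _))// mulr_suml ler_sum// => i _.
rewrite normrM mulrC ler_pM//; last exact: coord_le_norm.
rewrite mxE; apply: HM.
(* The segment stays in the ball by convexity of the norm. *)
rewrite (_ : y + _ = (1 - t) *: y + t *: x); last first.
  by rewrite scalerBr scalerBl scale1r addrCA addrC.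
rewrite (le_trans (ler_normD _ _))// !normrZ !ger0_norm ?subr_ge0 ?(ltW t0) ?(ltW t1)//.
have : (1 - t) * `|y| <= (1 - t) * r by rewrite ler_wpM2l// subr_ge0 ltW.
have : t * `|x| <= t * r by rewrite ler_wpM2l// ltW.
lra.
Qed.

(** * Uniqueness for ordinary differential equations *)

Lemma bounded_on_segment (R : realType) (V : normedModType R) (h : R -> V)
  (a b : R) :
  continuous h -> exists M : R, forall t, (a <= t <= b)%R -> `|h t| <= M.
Proof.
move=> ch.
have /compact_bounded [M [_ HM]] : compact (h @` `[a, b]).
  by apply: continuous_compact; [exact: continuous_subspaceT|exact: segment_compact].
exists (M + 1) => t tab; apply: (HM (M + 1)); first by rewrite ltrDl.
by exists t => //=; rewrite in_itv.
Qed.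

(** [E t * expR (- K t)] is nonincreasing. *)
Lemma gronwall_le0 (R : realType) (E dE : R -> R) (K T : R) :
  (forall t : R, 0 < t < T -> is_derive t (1 : R) E (dE t)) ->
  continuous E -> (forall t, 0 < t < T -> dE t <= K * E t) ->
  0 <= T -> E 0 <= 0 -> E T <= 0.
Proof.
move=> dEP cE Ele; rewrite le_eqVlt => /predU1P[<-//|T0] E0.
pose w (t : R) := expR (- K * t).
have dw (t : R) : is_derive t (1 : R) w (- K * w t).
  by apply: (@is_derive_eq); rewrite /w mulrC scaler1.
pose dW (t : R) := E t * (- K * w t) + w t * dE t.
have dWP t : t \in `]0, T[%R -> is_derive t (1 : R) (E * w) (dW t).
  move=> /[!in_itv]/= tT.
  exact: (is_deriveM (dEP _ tT) (dw t)).
have cW : {within `[0, T], continuous (E * w)}.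
  apply: continuous_subspaceT => t.
  by apply: continuousM; [exact: cE|exact: is_derive_continuous (dw t)].
have [t /[!in_itv]/= tT] := MVT T0 dWP cW.
rewrite subr0 => WE.
have dW0 : dW t <= 0.
  rewrite /dW (_ : _ + _ = w t * (dE t - K * E t)); last by ring.
  by rewrite mulr_ge0_le0 ?expR_ge0// subr_le0 Ele.
have : (E * w) T <= 0.
  have w0 : 0 <= w 0 by exact: expR_ge0.
  have -> : (E * w) T = dW t * T + E 0 * w 0.
    by rewrite -WE; rewrite [(E * w) 0]/(E 0 * w 0) subrK.
  have := mulr_le0_ge0 dW0 (ltW T0); have := mulr_le0_ge0 E0 w0; lra.
by rewrite [X in X <= 0]/(E T * w T) pmulr_lle0// expR_gt0.
Qed.

(** Only the direction field [X] is autonomous: the scalar factor [c t] lets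
    the lemma compare a solution with a reparametrised curve, and also run a
    curve backwards. Both solutions stay in a ball on [[0, T]], where [X] is
    Lipschitz, so the squared Euclidean distance [E] satisfies [E' <= K E]
    with [E 0 = 0]. *)
Lemma ode_unique (R : realType) (n : nat) (X : 'rV[R]_n -> 'rV[R]_n)
  (c : R -> R) (x y : R -> 'rV[R]_n) :
  (forall i, class_C 1 (fun u => X u 0 i)) -> continuous c ->
  continuous x -> continuous y -> x 0 = y 0 ->
  (forall t : R, 0 < t -> is_derive t (1 : R) x (c t *: X (x t))) ->
  (forall t : R, 0 < t -> is_derive t (1 : R) y (c t *: X (y t))) ->
  forall T, 0 <= T -> x T = y T.
Proof.
move=> CX cc cx cy xy0 dx dy T T0.
have [rx Hx] := bounded_on_segment 0 T cx.
have [ry Hy] := bounded_on_segment 0 T cy.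
have [C HC] := bounded_on_segment 0 T cc.
pose r := Num.max rx ry.
have [L HL] := choice (fun i => locally_lipschitz r (CX i)).
pose E (t : R) := \sum_(i < n) (x t 0 i - y t 0 i) ^+ 2.
pose dE (t : R) := \sum_(i < n) 2 * (x t 0 i - y t 0 i) *
  (c t * (X (x t) 0 i - X (y t) 0 i)).
(* The absolute values make [K] nonnegative. *)
pose K := \sum_(i < n) 2 * (C * `|L i|).
have dEP (t : R) : 0 < t -> is_derive t (1 : R) E (dE t).
  move=> t0.
  have dxi i := is_derive_coord i (dx t t0).
  have dyi i := is_derive_coord i (dy t t0).
  have dsq i := is_deriveX 2 (is_deriveB (dxi i) (dyi i)).
  have := is_derive_sum dsq; rewrite fct_sumE => dsum.
  apply: (is_derive_eq dsum); apply: eq_bigr => i _.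
  by rewrite !mxE -mulrBr.
have cE : continuous E.
  move=> t; apply: cvg_big => [|i _]; first exact: add_continuous.
  apply: (@cvg_comp _ _ _ (fun s => x s 0 i - y s 0 i) (fun z => z ^+ 2));
    last exact: exprn_continuous.
  apply: cvgB.
    exact: (continuous_comp (cx t) (@coord_continuous _ _ _ _ _ _)).
  exact: (continuous_comp (cy t) (@coord_continuous _ _ _ _ _ _)).
have dE_le t : 0 < t < T -> dE t <= K * E t.
  move=> /andP[t0 tT].
  have tT' : 0 <= t <= T by rewrite !ltW.
  have C0 : 0 <= C := le_trans (normr_ge0 _) (HC t tT').
  apply: (@le_trans _ _ (K * `|x t - y t| ^+ 2)); last first.
    rewrite ler_wpM2l//.
      by rewrite /K sumr_ge0// => i _; rewrite !mulr_ge0.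
    apply: le_trans (norm2_le_sum _) _.
    by apply: ler_sum => i _; rewrite !mxE.
  rewrite /K mulr_suml; apply: ler_sum => i _.
  have d1 : `|x t 0 i - y t 0 i| <= `|x t - y t|.
    by have := coord_le_norm (x t - y t) i; rewrite !mxE.
  have d2 : `|X (x t) 0 i - X (y t) 0 i| <= `|L i| * `|x t - y t|.
    apply: (@le_trans _ _ (L i * `|x t - y t|)).
      by apply: HL; rewrite /r le_max ?Hx ?Hy ?orbT.
    by rewrite ler_wpM2r// ler_norm.
  apply: le_trans (ler_norm _) _; rewrite !normrM normr_nat.
  rewrite [leRHS](_ : _ =
    2 * `|x t - y t| * (C * (`|L i| * `|x t - y t|))); last by ring.
  rewrite ler_pM// ?mulr_ge0// ?ler_pM2l// ler_pM//.
  exact: HC.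
have E0 : E 0 <= 0.
  by rewrite /E big1// => i _; rewrite xy0 subrr expr0n.
have := gronwall_le0 (fun t tT => dEP t (andP tT).1) cE dE_le T0 E0.
move=> ET; apply/eqP; rewrite -subr_eq0 -normr_eq0 -sqrf_eq0 eq_le sqr_ge0 andbT.
apply: le_trans (norm2_le_sum _) _; apply: le_trans ET.
by apply: ler_sum => i _; rewrite !mxE.
Qed.

(** * Primitives, time averages and coercivity *)

Lemma continuous_integrable_itv (R : realType) (h : R -> R) (a b : R) :
  continuous h ->
  (@lebesgue_measure R).-integrable `[a, b] (EFin \o h).
Proof.
move=> ch; apply: continuous_compact_integrable; first exact: segment_compact.
exact: continuous_subspaceT.
Qed.

(** The fundamental theorem of calculus for a fixed lower bound [- N] gives a
    derivative only to the right of [- N], so the lower bound has to move with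
    the point: [P N x - P N 0] does not depend on [N] as long as
    [`|x| <= N], and a common [N] serves a whole neighbourhood of [x]. *)
Lemma antiderivative (R : realType) (h : R -> R) : continuous h ->
  exists2 A : R -> R, A 0 = 0 & forall x : R, is_derive x (1 : R) A (h x).
Proof.
move=> ch.
pose P (N x : R) := \int[lebesgue_measure]_(t in `[- N, x]) h t.
pose A (x : R) := P (`|x| + 1) x - P (`|x| + 1) 0.
have dP (N x : R) : - N < x -> is_derive x (1 : R) (P N) (h x).
  move=> Nx; have x1 : x < x + 1 by rewrite ltrDl.
  have [] := continuous_FTC1_closed x1
    (continuous_integrable_itv (- N) (x + 1) ch) Nx (ch x).
  by move=> dP dPE; apply: DeriveDef; [exact: dP|rewrite -derive1E dPE].
have PE (M N x : R) : `|x| <= M -> M <= N -> P N x - P N 0 = P M x - P M 0.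
  move=> xM MN.
  have split_int (L z : R) : M <= L -> `|z| <= M -> P L z =
      P L (- M) + \int[lebesgue_measure]_(t in `]- M, z]) h t.
    rewrite ler_norml => ML /andP[Mz _].
    rewrite -(@Rintegral_itvB _ _ (BLeft (- L))) ?subrKC ?bnd_simp ?lerN2//.
    exact: continuous_integrable_itv.
  have M0 : `|0 : R| <= M by rewrite normr0; apply: le_trans xM.
  rewrite (split_int N x)// (split_int N 0)// (split_int M x)// (split_int M 0)//.
  lra.
exists A.
  by rewrite /A subrr.
move=> x.
pose N := `|x| + 2.
have Nx : - N < x by have := ler_norm (- x); rewrite normrN /N; lra.
apply: (@near_eq_is_derive _ _ _ (fun y => P N y - P N 0)).
  near=> y.
  rewrite /A; apply: PE; first by rewrite lerDl.
  rewrite /N; suff : `|y| <= `|x| + 1 by lra.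
  rewrite -lerBlDl; apply: le_trans (lerB_dist _ _) _; rewrite distrC.
  by near: y; apply: cvgr_dist_le => //; exact: cvg_id.
by have := is_deriveB (dP N x Nx) (is_derive_cst (P N 0) x (1 : R)); rewrite subr0.
Unshelve. all: by end_near. Qed.

Lemma time_average_derivative (R : realType) (h A : R -> R) (T : R) :
  continuous h -> continuous A ->
  (forall t : R, 0 < t -> is_derive t (1 : R) A (h t)) ->
  0 < T -> time_average h T = T^-1 * (A T - A 0).
Proof.
move=> ch cA dA T0; rewrite /time_average /Rintegral.
rewrite (@continuous_FTC2 _ h A)//.
- exact: continuous_subspaceT.
- split.
  + by move=> t /[!in_itv]/= /andP[t0 _]; have [] := dA t t0.
  + exact/cvg_at_right_filter/cA.
  + exact/cvg_at_left_filter/cA.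
- move=> t /[!in_itv]/= /andP[t0 _]; rewrite derive1E.
  by have [] := dA t t0.
Qed.

Lemma eq_time_average (R : realType) (h k : R -> R) (T : R) :
  (forall t, 0 <= t -> h t = k t) -> time_average h T = time_average k T.
Proof.
move=> hk; congr (_ * _); apply: eq_Rintegral => t /[!inE]/=.
by rewrite in_itv/= => /andP[t0 _]; exact: hk.
Qed.

(** The average up to [T] differs from [c] by [(A T - A 0) / T]. *)
Lemma time_average_cvg (R : realType) (h A : R -> R) (c K : R) :
  continuous h -> continuous A ->
  (forall t : R, 0 < t -> is_derive t (1 : R) A (h t - c)) ->
  (forall t, 0 <= t -> `|A t| <= K) ->
  time_average h T @[T --> +oo] --> c.
Proof.
move=> ch cA dA AK.
pose B := fun t : R => A t + c * t.
have dct (t : R) : is_derive t (1 : R) (fun s : R => c * s) c.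
  by have := is_deriveZ c (is_derive_id t (1 : R)); rewrite [c *: 1]mulr1.
have dB (t : R) : 0 < t -> is_derive t (1 : R) B (h t).
  by move=> /dA dAt; apply: (is_derive_eq (is_deriveD dAt (dct t))); rewrite subrK.
have cB : continuous B.
  move=> t; apply: cvgD; first exact: cA.
  exact: is_derive_continuous (dct t).
apply/cvgrPdist_le => e e0; near=> T.
have T0 : 0 < T by near: T; exact: nbhs_pinfty_gt.
rewrite (time_average_derivative ch cB dB T0) /B mulr0 addr0.
rewrite (_ : c - _ = - (T^-1 * (A T - A 0))); last first.
  rewrite addrAC mulrDr [T^-1 * (c * T)]mulrCA mulVf ?gt_eqF// mulr1.
  by rewrite opprD addrCA subrr addr0.
rewrite normrN normrM gtr0_norm ?invr_gt0// ler_pdivrMl//.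
apply: le_trans (ler_normB _ _) _.
apply: (@le_trans _ _ (2 * K)).
  by rewrite mulr_natl mulr2n lerD// AK// ltW.
rewrite -ler_pdivrMr//; near: T; apply: nbhs_pinfty_ge; exact: num_real.
Unshelve. all: by end_near. Qed.

(** [A] is convex with minimum at [s], and outside [[s - 1, s + 1]] its slope
    is at least [h (s + 1) - p] to the right and at most [h (s - 1) - p] to
    the left; both are nonzero because [h] increases strictly. *)
Lemma increasing_primitive_coercive (R : realType) (h A : R -> R) (s p : R) :
  {homo h : x y / x < y} -> h s = p ->
  (forall x : R, is_derive x (1 : R) A (h x - p)) ->
  exists k M : R, 0 < k /\ forall x, k * `|x| - M <= A x.
Proof.
move=> h_inc hs dA.
have mvt x y : x <= y -> exists2 z, x <= z <= y & A y - A x = (h z - p) * (y - x).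
  move=> xy; have [|z zxy ->] := MVT_segment xy (fun z _ => dA z).
    by apply: continuous_subspaceT => z; exact: is_derive_continuous (dA z).
  by exists z => //; rewrite in_itv in zxy.
have h_mono : {homo h : x y / x <= y} by exact: ltW_homo.
pose k := Num.min (h (s + 1) - p) (p - h (s - 1)).
have k0 : 0 < k.
  by rewrite lt_min !subr_gt0 -hs !h_inc// ?ltrDl// gtrBl.
have kr : k <= h (s + 1) - p by rewrite ge_min lexx.
have kl : k <= p - h (s - 1) by rewrite ge_min lexx orbT.
have A_s x : A s <= A x.
  have [xs|/ltW sx] := leP x s.
    have [z /andP[xz zs] AE] := mvt _ _ xs.
    have := h_mono _ _ zs; rewrite hs => hz.
    by rewrite -subr_le0 AE mulr_le0_ge0// ?subr_le0// subr_ge0.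
  have [z /andP[sz zx] AE] := mvt _ _ sx.
  have := h_mono _ _ sz; rewrite hs => hz.
  by rewrite -subr_ge0 AE mulr_ge0// subr_ge0.
suff H x : A s + k * (`|x - s| - 1) <= A x.
  exists k, (k * (`|s| + 1) - A s); split => // x.
  apply: le_trans (H x).
  have : k * `|x| <= k * (`|x - s| + `|s|).
    by rewrite ler_pM2l// -{1}(subrK s x) ler_normD.
  lra.
have [x1|x1] := leP `|x - s| 1.
  by apply: le_trans (A_s x); rewrite gerDl pmulr_rle0// subr_le0.
have [xs|sx] := leP x s.
  have xs1 : x <= s - 1 by move: x1; rewrite ler0_norm ?subr_le0//; lra.
  have [z /andP[xz zs] AE] := mvt _ _ xs1.
  have : k * (s - 1 - x) <= (p - h z) * (s - 1 - x).
    rewrite ler_wpM2r ?subr_ge0//; have := h_mono _ _ zs; lra.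
  have := A_s (s - 1); rewrite ler0_norm ?subr_le0//.
  lra.
have xs1 : s + 1 <= x by move: x1; rewrite gtr0_norm ?subr_gt0//; lra.
have [z /andP[xz zs] AE] := mvt _ _ xs1.
have : k * (x - (s + 1)) <= (h z - p) * (x - (s + 1)).
  rewrite ler_wpM2r ?subr_ge0//; have := h_mono _ _ xz; lra.
have := A_s (s + 1); rewrite gtr0_norm ?subr_gt0//.
lra.
Qed.

(** By the chain rule, the last hypothesis makes [Phi (a t) + Psi (b t)]
    constant. Both summands are bounded below, hence also above, and coercivity
    confines [a] and [b]. *)
Lemma energy_bounded (R : realType) (Phi Psi dPhi dPsi a b c d : R -> R) :
  (forall s : R, is_derive s (1 : R) Phi (dPhi s)) ->
  (forall s : R, is_derive s (1 : R) Psi (dPsi s)) ->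
  (exists k M : R, 0 < k /\ forall s, k * `|s| - M <= Phi s) ->
  (exists k M : R, 0 < k /\ forall s, k * `|s| - M <= Psi s) ->
  (forall t : R, is_derive t (1 : R) a (c t)) ->
  (forall t : R, is_derive t (1 : R) b (d t)) ->
  (forall t, 0 < t -> dPhi (a t) * c t + dPsi (b t) * d t = 0) ->
  exists K : R, forall t, 0 <= t -> `|a t| <= K /\ `|b t| <= K.
Proof.
move=> PhiP PsiP [k [M [k0 HPhi]]] [l [N [l0 HPsi]]] da db balance.
pose H := fun t : R => Phi (a t) + Psi (b t).
have dH (t : R) : is_derive t (1 : R) H (dPhi (a t) * c t + dPsi (b t) * d t).
  exact: is_deriveD (is_derive1_comp (PhiP (a t)) (da t))
    (is_derive1_comp (PsiP (b t)) (db t)).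
have Hcst t : 0 <= t -> H t = H 0.
  rewrite le_eqVlt => /predU1P[<-//|t0].
  have [|s /[!in_itv]/= /andP[s0 _]] := MVT t0 (fun s _ => dH s).
    by apply: continuous_subspaceT => s; exact: is_derive_continuous (dH s).
  by rewrite balance// mul0r => /eqP; rewrite subr_eq0 => /eqP.
pose B := H 0 + M + N.
exists (B / k + B / l) => t t0.
have := HPhi (a t); have := HPsi (b t); have := Hcst t t0; rewrite /H => HE Hb Ha.
have ka : 0 <= k * `|a t| by rewrite mulr_ge0// ltW.
have lb : 0 <= l * `|b t| by rewrite mulr_ge0// ltW.
have B0 : 0 <= B by rewrite /B /H; lra.
have aB : `|a t| <= B / k by rewrite ler_pdivlMr// mulrC /B /H; lra.
have bB : `|b t| <= B / l by rewrite ler_pdivlMr// mulrC /B /H; lra.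
have Bk : 0 <= B / k by rewrite divr_ge0// ltW.
have Bl : 0 <= B / l by rewrite divr_ge0// ltW.
by split; lra.
Qed.

(** * Gradient ascent curves *)

Lemma smooth_grad (R : realType) (n : nat) (f : 'rV[R]_n -> R) (i : 'I_n) :
  smooth f -> class_C 1 (fun u => grad f u 0 i).
Proof.
move=> fs; rewrite (_ : (fun u => grad f u 0 i) = partial i f).
  by have [_] := fs 2%N; exact.
by apply/funext => u; rewrite mxE.
Qed.

(** If the curve met a stationary point [gam s], then the curve run from [gam s]
    back to [x0] and the constant curve at [gam s] would solve the same
    equation, so [x0] would be that stationary point. *)
Lemma gradient_ascent_grad_neq0 (R : realType) (n : nat) (f : 'rV[R]_n -> R)
  (x0 : 'rV[R]_n) (gam : R -> 'rV[R]_n) (s : R) :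
  smooth f -> gradient_ascent f x0 gam -> grad f x0 != 0 ->
  grad f (gam s) != 0.
Proof.
move=> fs [gam0 dgam]; apply: contra => /eqP gs0.
(* The speed [sg] points from time [s] towards time 0, whatever the sign of [s]. *)
pose sg := - Num.sg s.
pose b (t : R) := s + sg * t.
have db (t : R) : is_derive t (1 : R) b sg.
  have := is_deriveD (is_derive_cst s t (1 : R))
    (is_deriveZ sg (is_derive_id t (1 : R))).
  by rewrite add0r [_ *: 1]mulr1.
have dx (t : R) : is_derive t (1 : R) (gam \o b) (sg *: grad f (gam (b t))).
  exact: is_derive_reparam (dgam (b t)) (db t).
have := @ode_unique _ _ (grad f) (cst sg) (gam \o b) (cst (gam s))
  (fun i => smooth_grad i fs).
move=> /(_ (@cst_continuous _ _ _)) /(_ (fun t => is_derive_continuous (dx t))).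
move=> /(_ (@cst_continuous _ _ _)).
rewrite /= {1}/b mulr0 addr0 => /(_ erefl (fun t _ => dx t)).
have dc (t : R) : 0 < t ->
    is_derive t (1 : R) (cst (gam s)) (cst sg t *: grad f (gam s)).
  by move=> _; rewrite gs0 scaler0; exact: is_derive_cst.
move=> /(_ dc `|s| (normr_ge0 _)).
by rewrite /b /sg mulNr -numEsg subrr gam0 => ->; rewrite gs0.
Qed.

(** The derivative of [f] along the curve is the squared Euclidean norm of its
    gradient. *)
Lemma gradient_ascent_increasing (R : realType) (n : nat)
  (f : 'rV[R]_n -> R) (x0 : 'rV[R]_n) (gam : R -> 'rV[R]_n) :
  smooth f -> gradient_ascent f x0 gam -> grad f x0 != 0 ->
  {homo f \o gam : x y / x < y}.
Proof.
move=> fs ag gx0 x y xy.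
have df : forall u, differentiable f u by have [] := fs 1%N.
have dF t := is_derive_comp_grad (df (gam t)) (ag.2 t).
have [|t _ FE] := MVT xy (fun t _ => dF t).
  by apply: continuous_subspaceT => t; exact: is_derive_continuous (dF t).
rewrite -subr_gt0 FE mulr_gt0 ?subr_gt0//.
have := gradient_ascent_grad_neq0 t fs ag gx0.
rewrite -normr_eq0 -(@sqrf_eq0 R) => nz.
apply: (@lt_le_trans _ _ (`|grad f (gam t)| ^+ 2)).
  by rewrite lt_neqAle eq_sym nz sqr_ge0.
exact: norm2_le_sum.
Qed.

(** Freezing a trajectory at its initial value for negative times replaces
    one-sided continuity at 0 by plain continuity on the line. *)
Lemma continuous_extension (R : realType) (V : topologicalType) (x : R -> V) :
  {within `[0, +oo[, continuous x} ->
  continuous (fun t : R => x (Num.max t 0)).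
Proof.
move=> /subspace_continuousP cx t.
have A0 (s : R) : `[0, +oo[%classic (Num.max s 0).
  by rewrite /= in_itv/= le_max lexx orbT.
apply: (@cvg_comp _ _ _ (fun s : R => Num.max s 0) x _ _ _ _ (cx _ (A0 t))).
move=> W HW.
have cm : {for t, continuous (fun s : R => Num.max s 0)}.
  by apply: continuous_max; [exact: cvg_id|exact: cvg_cst].
have near_impl : \forall s \near t,
    `[0, +oo[%classic (Num.max s 0) -> W (Num.max s 0) by exact: cm _ HW.
suff : \forall s \near t, W (Num.max s 0) by [].
by apply: filterS near_impl => s; apply; exact: A0.
Qed.

(** All that the dynamics retains of one player: the value [f] along the
    trajectory is a function [F] of one real variable, the displacement [a]
    along the ascent curve, and [F - p] has a coercive primitive [Phi]. *)
Lemma ascent_potential (R : realType) (n : nat) (f : 'rV[R]_n -> R)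
  (x0 : 'rV[R]_n) (p : R) :
  smooth f -> grad f x0 != 0 -> ascent_values f x0 p ->
  exists F Phi : R -> R, [/\
    forall s : R, is_derive s (1 : R) Phi (F s - p),
    exists k M : R, 0 < k /\ forall s, k * `|s| - M <= Phi s &
    forall (x : R -> 'rV[R]_n) (c a : R -> R),
      continuous x -> continuous c -> x 0 = x0 ->
      a 0 = 0 -> (forall t : R, is_derive t (1 : R) a (c t)) ->
      (forall t : R, 0 < t -> is_derive t (1 : R) x (c t *: grad f (x t))) ->
      forall t, 0 <= t -> f (x t) = F (a t)].
Proof.
move=> fs gx0 [gam ag [s gsp]].
have [gam0 dgam] := ag.
have df : forall u, differentiable f u by have [] := fs 1%N.
have dF t := is_derive_comp_grad (df (gam t)) (dgam t).
have cF : continuous (fun s => f (gam s) - p).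
  move=> t; apply: cvgB; last exact: cvg_cst.
  exact: is_derive_continuous (dF t).
have [Phi _ dPhi] := antiderivative cF.
exists (f \o gam), Phi; split => //.
  have F_inc := gradient_ascent_increasing fs ag gx0.
  exact: increasing_primitive_coercive F_inc gsp dPhi.
move=> x c a cx cc x_0 a0 da dx t t0 /=; congr f.
have dga (u : R) : is_derive u (1 : R) (gam \o a) (c u *: grad f (gam (a u))).
  exact: is_derive_reparam (dgam (a u)) (da u).
apply: (@ode_unique _ _ (grad f) c x (gam \o a)) => //.
- by move=> i; exact: smooth_grad.
- by move=> u; exact: is_derive_continuous (dga u).
- by rewrite /= a0 gam0.
Qed.

(** * Time averages of the dynamics *)

(** At the equilibrium each player makes the other indifferent, so the terms of
    the bilinear payoff that are linear in [x - p] or [y - q] vanish. *)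
Lemma payoff_sub (R : realType) (U : 'M[R]_2) (v p q x y : R) :
  v = U 0 0 - U 0 1 - U 1 0 + U 1 1 -> v * q = - (U 0 1 - U 1 1) ->
  v * p = - (U 1 0 - U 1 1) ->
  payoff U (mixed x) (mixed y) - payoff U (mixed p) (mixed q) =
  v * ((x - p) * (y - q)).
Proof.
move=> vE vq vp.
have pE x' y' : payoff U (mixed x') (mixed y') =
    v * (x' * y') - v * q * x' - v * p * y' + U 1 1.
  rewrite vq vp vE /payoff !mxE !big_ord_recl !big_ord0.
  rewrite !mxE !big_ord_recl !big_ord0 !mxE/=.
  rewrite (_ : lift ord0 ord0 = 1 :> 'I_2)/=; last exact/val_inj.
  rewrite (_ : ord0 = 0 :> 'I_2)//.
  ring.
by rewrite !pE; ring.
Qed.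

Theorem theorem4 (R : realType) (n m : nat)
  (f : 'rV[R]_n -> R) (g : 'rV[R]_m -> R)
  (f01 : forall x, 0 <= f x <= 1) (g01 : forall y, 0 <= g y <= 1)
  (f_smooth : smooth f) (g_smooth : smooth g)
  (U : 'M[R]_2) (v p q : R)
  (v_def : v = U 0 0 - U 0 1 - U 1 0 + U 1 1) (v_neq0 : v != 0)
  (q_def : q = - ((U 0 1 - U 1 1) / v)) (q01 : 0 < q < 1)
  (p_def : p = - ((U 1 0 - U 1 1) / v)) (p01 : 0 < p < 1)
  (theta0 : 'rV[R]_n) (phi0 : 'rV[R]_m)
  (safe0 : safe f g p q theta0 phi0)
  (theta : R -> 'rV[R]_n) (phi : R -> 'rV[R]_m)
  (sol : gda_solution f g v p q theta0 phi0 theta phi) :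
  let r (x : 'rV[R]_n) (y : 'rV[R]_m) :=
    payoff U (mixed (f x)) (mixed (g y)) in
  [/\ time_average (fun t => f (theta t)) T @[T --> +oo] --> p,
      time_average (fun t => r (theta t) (phi t)) T @[T --> +oo]
        --> payoff U (mixed p) (mixed q) &
      time_average (fun t => g (phi t)) T @[T --> +oo] --> q].
Proof.
move=> r.
case: sol => -[theta_0 phi_0] ctheta cphi dsol.
case: safe0 => gf0 gg0 pf qg.
pose x (t : R) := theta (Num.max t 0).
pose y (t : R) := phi (Num.max t 0).
have xE t : 0 <= t -> x t = theta t by move=> t0; rewrite /x max_l.
have yE t : 0 <= t -> y t = phi t by move=> t0; rewrite /y max_l.
have cx : continuous x := continuous_extension ctheta.
have cy : continuous y := continuous_extension cphi.
have cf : continuous f := f_smooth 0%N.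
have cg : continuous g := g_smooth 0%N.
have cfx : continuous (fun t => f (x t)).
  by move=> t; exact: (continuous_comp (cx t) (cf _)).
have cgy : continuous (fun t => g (y t)).
  by move=> t; exact: (continuous_comp (cy t) (cg _)).
pose c (t : R) := - (v * (g (y t) - q)).
pose d (t : R) := v * (f (x t) - p).
have cc : continuous c.
  move=> t; apply: cvgN; apply: cvgMr.
  by apply: cvgB; [exact: cgy|exact: cvg_cst].
have cd : continuous d.
  move=> t; apply: cvgMr.
  by apply: cvgB; [exact: cfx|exact: cvg_cst].
have near_pos (t : R) : 0 < t -> \forall s \near t, 0 <= s.
  by move=> t0; near=> s; apply: ltW; near: s; exact: lt_nbhsr.
have dx (t : R) : 0 < t -> is_derive t (1 : R) x (c t *: grad f (x t)).
  move=> t0; have [dt _] := dsol t t0.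
  apply: (near_eq_is_derive _ (_ : is_derive t (1 : R) theta _)).
    by apply: filterS (near_pos t t0) => s s0; rewrite xE.
  by rewrite /c xE ?yE ?ltW.
have dy (t : R) : 0 < t -> is_derive t (1 : R) y (d t *: grad g (y t)).
  move=> t0; have [_ dt] := dsol t t0.
  apply: (near_eq_is_derive _ (_ : is_derive t (1 : R) phi _)).
    by apply: filterS (near_pos t t0) => s s0; rewrite yE.
  by rewrite /d xE ?yE ?ltW.
have [a a0 da] := antiderivative cc.
have [b b0 db] := antiderivative cd.
have [F [Phi [dPhi coPhi FE]]] := ascent_potential f_smooth gf0 pf.
have [G [Psi [dPsi coPsi GE]]] := ascent_potential g_smooth gg0 qg.
have x0E : x 0 = theta0 by rewrite xE.
have y0E : y 0 = phi0 by rewrite yE.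
have {}FE := FE x c a cx cc x0E a0 da dx.
have {}GE := GE y d b cy cd y0E b0 db dy.
have [|K HK] := energy_bounded dPhi dPsi coPhi coPsi da db.
  by move=> t t0; rewrite -FE ?ltW// -GE ?ltW// /c /d; ring.
have ca : continuous a by move=> t; exact: is_derive_continuous (da t).
have cb : continuous b by move=> t; exact: is_derive_continuous (db t).
have cPhi : continuous Phi by move=> s; exact: is_derive_continuous (dPhi s).
have [L HL] := bounded_on_segment (- K) K cPhi.
have avgE (h k : R -> R) : (forall t, 0 <= t -> h t = k t) ->
    time_average h = time_average k.
  by move=> hk; apply/funext => T; exact: eq_time_average.
have vq : v * q = - (U 0 1 - U 1 1) by rewrite q_def mulrN mulrCA divff ?mulr1.
have vp : v * p = - (U 1 0 - U 1 1) by rewrite p_def mulrN mulrCA divff ?mulr1.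
split.
- rewrite (avgE _ (fun t => f (x t))); last by move=> t t0; rewrite xE.
  apply: (@time_average_cvg _ _ (v^-1 *: b) _ (`|v^-1| * K)) => //.
  + by move=> t; apply: cvgZr; exact: cb.
  + move=> t t0; have := is_deriveZ v^-1 (db t).
    by rewrite /d [_ *: _](mulKf v_neq0).
  + by move=> t t0; rewrite normrM ler_wpM2l//; have [] := HK t t0.
- rewrite (avgE _ (fun t => r (x t) (y t))); last first.
    by move=> t t0; rewrite xE ?yE.
  have rE t : r (x t) (y t) = payoff U (mixed p) (mixed q) +
      v * ((f (x t) - p) * (g (y t) - q)).
    by rewrite -(payoff_sub _ _ v_def vq vp) subrKC.
  apply: (@time_average_cvg _ _ (- (Phi \o a)) _ L).
  + rewrite (_ : (fun t => _) = (fun t => payoff U (mixed p) (mixed q) +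
      v * ((f (x t) - p) * (g (y t) - q)))); last exact/funext.
    move=> t; apply: cvgD; first exact: cvg_cst.
    apply: cvgMr; apply: cvgM.
      by apply: cvgB; [exact: cfx|exact: cvg_cst].
    by apply: cvgB; [exact: cgy|exact: cvg_cst].
  + by move=> t; apply: cvgN; exact: (continuous_comp (ca t) (cPhi _)).
  + move=> t t0; have dPhia := is_derive1_comp (dPhi (a t)) (da t).
    apply: (is_derive_eq (is_deriveN dPhia)).
    by rewrite rE -FE ?ltW// /c; ring.
  + by move=> t t0; rewrite normrN; apply: HL; rewrite -ler_norml; have [] := HK t t0.
- rewrite (avgE _ (fun t => g (y t))); last by move=> t t0; rewrite yE.
  apply: (@time_average_cvg _ _ (- v^-1 *: a) _ (`|- v^-1| * K)) => //.
  + by move=> t; apply: cvgZr; exact: ca.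
  + move=> t t0; have := is_deriveZ (- v^-1) (da t).
    by rewrite /c [_ *: _]mulrNN mulKf.
  + by move=> t t0; rewrite normrM ler_wpM2l//; have [] := HK t t0.
Unshelve. all: by end_near. Qed.
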